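(* Let $i\in\{0,2\}$. Let $f$, $g$ be functions (for $i=0$, with a common codomain $\underline{Z}$) such that neither $f\leq_i g$ nor $g\leq_i f$ holds, and let $h$ be a function that is an infimum (greatest lower bound) of $f$ and $g$ with respect to $\leq_i$ among functions (in $\mathbb{F}_i$). Then the problem $\{h\}$ is not an infimum of $\{f\}$ and $\{g\}$ with respect to $\leq_i$ among problems (in $\mathbb{P}_i$). In particular, binary infima in $(\mathbb{F}_i,\leq_i)$ are in general not binary infima in $(\mathbb{P}_i,\leq_i)$.
   Context: A partial function $F:\subseteq X\to Y$ is a function from $\operatorname{dom}(F)\subseteq X$ to $Y$; it is continuous if continuous on its domain with the subspace topology. A problem $P:\underline{X}\to\underline{Y}$ is a set of partial functions from $\underline{X}$ to $\underline{Y}$; a function $f$ is identified with the problem $\{f\}$. $\leq_2$ on problems: for $P:\underline{X}_1\to\underline{Y}_1$, $Q:\underline{X}_2\to\underline{Y}_2$, $P\leq_2 Q$ iff there are continuous partial $F:\subseteq\underline{X}_1\times\underline{Y}_2\to\underline{Y}_1$, $G:\subseteq\underline{X}_1\to\underline{X}_2$ with $(x\mapsto F(x,g(G(x))))\in P$ for all $g\in Q$. $\leq_0$ on problems with common codomain $\underline{Z}$: for $P:\underline{X}\to\underline{Z}$, $Q:\underline{Y}\to\underline{Z}$, $P\leq_0 Q$ iff there is a continuous partial $G:\subseteq\underline{X}\to\underline{Y}$ with $g\circ G\in P$ for all $g\in Q$. For functions (singleton problems) these give the usual $\leq_2$ (resp. $\leq_0$: $f=g\circ G$ with $G$ continuous).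 $\mathbb{F}_i$ and $\mathbb{P}_i$ are the classes of $\leq_i$-equivalence classes of functions, respectively problems. *)

(* Defs.v *)
From HB Require Import structures.
From mathcomp Require Import all_boot all_classical topology.

Set Implicit Arguments.
Unset Strict Implicit.
Unset Printing Implicit Defensive.

Local Open Scope classical_set_scope.

(* A partial function is encoded by its option-valued extension: [None] outside
   of the domain. With functional extensionality, two partial functions are
   equal iff they have the same domain and the same values on it. *)
Definition pfun (X Y : Type) := X -> option Y.

Definition dom (X Y : Type) (f : pfun X Y) : set X := [set x | f x <> None].

Definition pcomp (X Y Z : Type) (g : pfun Y Z) (f : pfun X Y) : pfun X Z :=
  fun x => obind g (f x).

(* The partial function x |-> (x, f x). *)
Definition pgraph (X Y : Type) (f : pfun X Y) : pfun X (X * Y) :=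
  fun x => omap (pair x) (f x).

(* Continuity on the domain, equipped with the subspace topology. *)
Definition pcontinuous (X Y : topologicalType) (f : pfun X Y) :=
  forall V : set Y, open V ->
    open (f @^-1` (Some @` V) : set (subspace (dom f))).

Definition is_infimum (T : Type) (le : T -> T -> Prop) (h f g : T) :=
  [/\ le h f, le h g & forall k, le k f -> le k g -> le k h].

Record problem := Problem {
  p_in : topologicalType;
  p_out : topologicalType;
  p_set : set (pfun p_in p_out) }.

Arguments p_set : clear implicits.

(* Functions are partial, like the elements of a problem; a partial function is
   equivalent, for both reducibilities, to its restriction to the space
   [dom f], so the degrees are those of the total functions. *)
Record func := Func {
  f_in : topologicalType;
  f_out : topologicalType;
  f_fun : pfun f_in f_out }.

Arguments f_fun : clear implicits.

Definition sing (f : func) : problem := Problem [set f_fun f].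

(* [pcomp F (pgraph (pcomp g G))] is x |-> F (x, g (G x)). *)
Definition le2 (P Q : problem) :=
  exists (F : pfun (p_in P * p_out Q)%type (p_out P))
         (G : pfun (p_in P) (p_in Q)),
    [/\ pcontinuous F, pcontinuous G &
        forall g, p_set Q g -> p_set P (pcomp F (pgraph (pcomp g G)))].

Definition fle2 (f g : func) := le2 (sing f) (sing g).

Record problem0 (Z : topologicalType) := Problem0 {
  p0_in : topologicalType;
  p0_set : set (pfun p0_in Z) }.

Arguments p0_set {Z} _ _.

Record func0 (Z : topologicalType) := Func0 {
  f0_in : topologicalType;
  f0_fun : pfun f0_in Z }.

Arguments f0_fun {Z} _ _.

Definition sing0 (Z : topologicalType) (f : func0 Z) : problem0 Z :=
  Problem0 [set f0_fun f].

Definition le0 (Z : topologicalType) (P Q : problem0 Z) :=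
  exists G : pfun (p0_in P) (p0_in Q),
    pcontinuous G /\ forall g, p0_set Q g -> p0_set P (pcomp g G).

Definition fle0 (Z : topologicalType) (f g : func0 Z) := le0 (sing0 f) (sing0 g).

(* Main.v *)
From HB Require Import structures.
From mathcomp Require Import all_boot all_classical topology wochoice.
(* [Defs] comes last because [ssrfun] also has a [pcomp]. *)
Require Import Defs.

(* If [f] and [g] are incomparable, the two-element problem {f, g}, living on
   the disjoint sums of the spaces, is below both {f} and {g}; were it below a
   singleton {h} with h <= f and h <= g, one of f <= h <= g and g <= h <= f
   would hold.

   The remaining point is that incomparable functions with an infimum exist.
   For i = 0, two distinct constants have the nowhere defined function as
   infimum. For i = 2, let [T] be an uncountable well-ordered set all of whose
   initial segments are countable, let q_0(x), q_1(x), ... enumerate the points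
   below x, and give [T] the coarsest topology making every q_n : T -> T locally
   constant. A regressive-function argument shows that [T] is not a countable
   union of discrete subspaces, and Ulam's matrix yields disjoint S, S' which are
   not either. Let f and g be the identities from S and S' (times an indiscrete
   copy of nat) to the discrete topology, and h the identity from the
   indiscrete to the discrete nat. A function k below f and g comes with
   continuous x(w) in S and y(w) in S', and is continuous where either is locally
   constant. One of x(w), y(w) is q_n of the other; splitting the domain of k
   into countably many pieces according to n and to which of the two cases
   holds makes one of them locally constant on each piece, so k <= h. But f <= h
   would make S a countable union of discrete subspaces. *)

Set Implicit Arguments.
Unset Strict Implicit.
Unset Printing Implicit Defensive.

Local Open Scope classical_set_scope.

(** * An uncountable well-order with countable initial segments *)

Lemma uncountable_powerset_nat : ~ countable [set: nat -> bool].
Proof.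
move=> /countable_injP[e inj_e].
(* Cantor's diagonal; the existential replaces a partial inverse of [e]. *)
pose d n := ~~ `[< exists2 x : nat -> bool, e x = n & x n >].
have : d (e d) = ~~ d (e d).
  rewrite {1}/d; congr (~~ _); apply/asboolP/idP => [[x ex xd]|dd]; last by exists d.
  by rewrite -(inj_e x d) ?inE ?ex.
by case: (d (e d)).
Qed.

(** [T] consists of the points with countable initial segment in a well-order of [nat -> bool]. Were
    it countable, some point would lie outside it, and the least such point would have its initial
    segment inside [T], hence countable. *)
Lemma uncountable_well_order : exists (T : choiceType) (le : rel T),
  [/\ well_order le, forall x, countable [set y | ~~ le x y]
    & ~ countable [set: T]].
Proof.
have [R woR] := well_ordering_principle (nat -> bool).
pose A := [set x : nat -> bool | countable [set y | ~~ R x y]].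
pose T := {x : nat -> bool | x \in A}.
have cseg (B : set T) : countable B <-> countable (val @` B).
  split; first by move=> cB; apply: sub_countable cB; exact: card_image_le.
  move=> /countable_injP[e inj_e]; apply/countable_injP.
  exists (e \o val) => x y; rewrite !inE => Bx By /= exy.
  by apply/val_inj/inj_e; rewrite // inE; [exists x|exists y].
exists T, (relpre val R); split.
- move=> B [b0 b0B].
  have [|z [[zB zmin] zuniq]] := woR [pred x | `[< exists2 b, b \in B & val b = x >]].
    by exists (val b0); apply/asboolP; exists b0.
  have /asboolP[b bB bz] := zB.
  exists b; split=> [|b' [b'B b'min]].
    split=> // x xB /=; rewrite bz; apply: zmin.
    by apply/asboolP; exists x.
  apply/val_inj; rewrite bz; apply: zuniq; split.
    by apply/asboolP; exists b'.
  by move=> y /asboolP[x xB <-]; exact: b'min.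
- move=> x; apply/cseg; have : A (val x) by have := valP x; rewrite inE.
  by apply: sub_countable; apply: subset_card_le => _ [y yx <-].
- move=> /cseg; have -> : [set val x | x in [set: T]] = A.
    apply/seteqP; split=> [_ [x _ <-]|x Ax]; first by have := valP x; rewrite inE.
    by exists (Sub x (mem_set Ax)).
  move=> cA.
  have [x nAx] : exists x, ~ A x.
    apply/existsNP => AT; apply: uncountable_powerset_nat.
    by apply: sub_countable cA; apply: subset_card_le => x _; exact: AT.
  have [|z [[zA zmin] _]] := woR [pred x | ~~ `[< A x >]].
    by exists x; apply/asboolPn.
  move/asboolPn: zA; apply.
  apply: sub_countable cA; apply: subset_card_le => y /= nzy.
  by apply: contrapT => nAy; case/negP: nzy; apply: zmin; exact/asboolPn.
Qed.

Lemma countableU1 (T : Type) (A : set T) (x : T) :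
  countable A -> countable (A `|` [set x]).
Proof.
move=> cA; have : countable (\bigcup_b if b then A else [set x]).
  by apply: bigcup_countable => // -[] _ //; exact: countable1.
apply: sub_countable; apply: subset_card_le => y [Ay|->].
  by exists true.
by exists false.
Qed.

Lemma countable_enumeration (T : Type) (A : set T) (x0 : T) : countable A ->
  exists s : nat -> T, (forall y, A y -> exists n, s n = y) /\
    (A !=set0 -> forall n, A (s n)).
Proof.
move=> /countable_injP[e inj_e].
have [->|/set0P[a Aa]] := eqVneq A set0; first by exists (fun=> x0); split=> // -[].
have /choice[s sP] : forall n, exists y, A y /\
    ((exists2 z, A z & e z = n) -> e y = n).
  move=> n; have [[z Az ezn]|nz] := pselect (exists2 z, A z & e z = n).
    by exists z.
  by exists a; split.
exists s; split=> [y Ay|_ n]; last by have [] := sP n.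
exists (e y); have [As /(_ (ex_intro2 _ _ y Ay erefl)) es] := sP (e y).
by apply: inj_e; rewrite ?inE.
Qed.

(** * Countable unions of discrete subspaces *)

(** The sets [agree q m x] are the basic neighbourhoods of [x] when every [q i] is made locally
    constant. *)
Definition agree (T V : Type) (q : nat -> T -> V) (m : nat) (x y : T) :=
  forall i, i < m -> q i y = q i x.

(** The discrete pieces are the colour classes of [c] in [S]. *)
Definition sigma_discrete (T V : Type) (q : nat -> T -> V) (S : set T) :=
  exists c : T -> nat, forall x, S x ->
    exists m, forall y, S y -> c y = c x -> agree q m x y -> y = x.

Lemma sigma_discrete_countable (T V : Type) (q : nat -> T -> V) (S : set T) :
  countable S -> sigma_discrete q S.
Proof.
move=> /countable_injP[c inj_c]; exists c => x Sx; exists 0 => y Sy cyx _.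
by apply: inj_c; rewrite ?inE.
Qed.

Lemma sigma_discrete_bigcup (T V : Type) (q : nat -> T -> V) (S : nat -> set T) :
  (forall n, sigma_discrete q (S n)) -> sigma_discrete q (\bigcup_n S n).
Proof.
move=> /choice[c cP].
have /choice[k kP] : forall x, exists n, (\bigcup_n S n) x -> S n x.
  move=> x; have [[n _ Sx]|nS] := pselect ((\bigcup_n S n) x); first by exists n.
  by exists 0.
exists (fun x => pickle (k x, c (k x) x)) => x Sx.
have [m mP] := cP _ _ (kP _ Sx); exists m => y Sy /(pcan_inj pickleK)[kyx].
by rewrite kyx; apply: mP; rewrite -kyx; exact: kP.
Qed.

(** * Regressive functions on the well-order *)

Section regressive.
Variables (T : choiceType) (le : rel T) (q : nat -> T -> T).
Hypothesis wo : well_order le.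
Hypothesis cseg : forall x, countable [set y | ~~ le x y].
Hypothesis uncT : ~ countable [set: T].
Hypothesis qP : forall x y, ~~ le x y -> exists n, q n x = y.
Hypothesis q_lt : forall x y, ~~ le x y -> forall n, ~~ le x (q n x).

Let leT : total le.
Proof. by move=> x y; apply: (@wo_chainW _ le predT (withinW wo)). Qed.

Let lexx : reflexive le.
Proof. by move=> x; have := leT x x; rewrite orbb. Qed.

Let le_anti : antisymmetric le.
Proof.
move=> x y; apply: (@wo_chain_antisymmetric _ le predT (withinW wo)) => //.
Qed.

Let le_trans : transitive le.
Proof.
move=> y x z xy yz.
have [|m [[mA mmin] _]] := wo (A := [pred u | [|| u == x, u == y | u == z]]).
  by exists x; rewrite inE eqxx.
have mx : le m x by apply: mmin; rewrite inE eqxx.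
have my : le m y by apply: mmin; rewrite inE eqxx orbT.
have mz : le m z by apply: mmin; rewrite inE eqxx !orbT.
case/or3P: mA => /eqP mE; rewrite {}mE in mx my mz => //.
- by rewrite (@le_anti x y) // xy mx.
- by rewrite -(@le_anti y z) // yz my.
Qed.

Let lt_trans x y z : ~~ le y x -> ~~ le z y -> ~~ le z x.
Proof.
move=> yx zy; apply: contra zy => zx.
by apply: le_trans zx _; have := leT x y; rewrite (negbTE yx) orbF.
Qed.

(** Otherwise the countably many countable sets of points at most [x], for [x] in [A], would cover
    [T]. *)
Let bounded (A : set T) : countable A -> exists b, forall x, A x -> ~~ le b x.
Proof.
move=> cA; apply/not_existsP => unb; apply: uncT.
have : countable (\bigcup_(x in A) ([set y | ~~ le x y] `|` [set x])).
  by apply: bigcup_countable => // x _; exact: countableU1.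
apply: sub_countable; apply: subset_card_le => b _.
have /existsNP[x /not_implyP[Ax /negP]] := unb b; rewrite negbK => bx.
exists x => //; have [xb|] := boolP (le x b); last by left.
by right; apply/le_anti/andP.
Qed.

(* A colouring by [c] would make [x |-> (c x, q 0 x, ..., q (m x).-1 x)]
   injective; a point [d] such that every [x] whose code has entries below [d]
   is itself below [d] then contradicts [q_lt]. *)
Lemma not_sigma_discreteT : ~ sigma_discrete q [set: T].
Proof.
move=> [c cP].
have /choice[m mP] : forall x, exists m, forall y, c y = c x ->
    agree q m x y -> y = x.
  by move=> x; have [m mP] := cP x I; exists m => y; exact: mP.
pose below b := [set x | forall i, i < m x -> ~~ le b (q i x)].
have cbelow b : countable (below b).
  have /countable_injP[e inj_e] := cseg b; apply/countable_injP.
  exists (fun x => pickle (c x, mkseq (fun i => e (q i x)) (m x))) => x y.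
  rewrite !inE => bx byy /(pcan_inj pickleK)[cxy eqs].
  have mxy : m x = m y by move/(congr1 size): eqs; rewrite !size_mkseq.
  apply: mP => // i im; apply: inj_e.
  - by rewrite inE; apply: bx; rewrite mxy.
  - by rewrite inE; exact: byy.
  - move/(congr1 (fun s => nth 0 s i)): eqs.
    by rewrite !nth_mkseq // mxy.
have /choice[nxt nxtP] : forall b, exists b', ~~ le b' b /\
    forall x, below b x -> ~~ le b' x.
  move=> b; have [|b' b'P] := @bounded (below b `|` [set b]).
    exact: countableU1.
  by exists b'; split=> [|x bx]; apply: b'P; [right|left].
have [t0 _] : [set: T] !=set0.
  by apply/set0P; apply/eqP => T0; apply: uncT; rewrite T0.
pose g n := iter n nxt t0.
have [|d0 d0P] := @bounded (range g).
  by apply: sub_countable (card_image_le _ _) _.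
(* [d] is the supremum of the strictly increasing [g n], so each [q i d], being below [d], is below
   some [g n]. *)
have [|d [[dA dmin] _]] := wo (A := [pred b | `[< forall n, ~~ le b (g n) >]]).
  by exists d0; apply/asboolP => n; apply: d0P; exists n.
have dg n : ~~ le d (g n) by have /asboolP := dA; apply.
have q_lt_g i : exists n, ~~ le (g n) (q i d).
  have dq := q_lt (dg 0) i.
  have : ~ (forall n, ~~ le (q i d) (g n)).
    by move=> H; have /negP := dq; apply; apply: dmin; apply/asboolP.
  move=> /existsNP[n /negP]; rewrite negbK => qg; exists n.+1.
  have [gS _] := nxtP (g n); apply: contra gS => gq; exact: le_trans gq qg.
(* One [g N] exceeds the finitely many entries of the code of [d]; then [d] is in [below (g N)],
   hence below [g N.+1], against [dg]. *)
have [N NP] : exists N, forall i, i < m d -> ~~ le (g N) (q i d).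
  elim: (m d) => [|k [N NP]]; first by exists 0.
  have [n np] := q_lt_g k.
  have gmono a b : a <= b -> forall x, ~~ le (g a) x -> ~~ le (g b) x.
    move=> /subnK <-; elim: (b - a) => [//|j IH] x /IH gx.
    by apply: lt_trans gx _; have [] := nxtP (g (j + a)).
  exists (maxn N n) => i; rewrite ltnS leq_eqVlt => /orP[/eqP->|ik].
    by apply: gmono np; rewrite leq_maxr.
  by apply: gmono (NP _ ik); rewrite leq_maxl.
have [_ /(_ d NP)] := nxtP (g N).
by apply/negP; rewrite negbK; have := leT d (g N.+1); rewrite (negbTE (dg _)).
Qed.

(* Ulam's matrix. *)
Lemma disjoint_not_sigma_discrete : exists S S' : set T,
  [/\ S `&` S' = set0, ~ sigma_discrete q S & ~ sigma_discrete q S'].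
Proof.
(* The sets [q n y = x] cover the points above [x], and only countably many points remain, so one of
   these sets is not sigma-discrete. *)
have /choice[k kP] : forall x, exists n, ~ sigma_discrete q [set y | q n y = x].
  move=> x; apply/existsNP => sdx; apply: not_sigma_discreteT.
  suff <- : \bigcup_n (if n is n'.+1 then [set y | q n' y = x]
                       else [set y | ~~ le x y] `|` [set x]) = setT.
    apply: sigma_discrete_bigcup => -[|n]; last exact: sdx.
    by apply: sigma_discrete_countable; exact: countableU1.
  apply/seteqP; split=> // y _.
  have [xy|] := boolP (le x y); last by exists 0 => //; left.
  have [yx|/qP[n qn]] := boolP (le y x); last by exists n.+1.
  by exists 0 => //; right; apply/le_anti/andP.
have [x [y [xy kxy]]] : exists x y, x <> y /\ k x = k y.
  apply: contrapT => H; apply: uncT; apply/countable_injP; exists k => x y _ _ kxy.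
  by apply: contrapT => xy; apply: H; exists x, y.
exists [set z | q (k x) z = x], [set z | q (k y) z = y]; split=> //.
by rewrite -subset0 => z [/= zx zy]; apply: xy; rewrite -[LHS]zx -[RHS]zy kxy.
Qed.

End regressive.

Lemma disjoint_not_sigma_discrete_ex :
  exists (T : choiceType) (q : nat -> T -> T) (S S' : set T),
  [/\ forall x y, [\/ x = y, exists n, q n x = y | exists n, q n y = x],
      S `&` S' = set0, ~ sigma_discrete q S & ~ sigma_discrete q S'].
Proof.
have [T [le [wo cseg uncT]]] := uncountable_well_order.
have /choice[s sP] := fun x => countable_enumeration x (cseg x).
pose q n x := s x n.
have qP x y : ~~ le x y -> exists n, q n x = y by have [+ _] := sP x; apply.
have q_lt x y : ~~ le x y -> forall n, ~~ le x (q n x).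
  by move=> xy n; have [_ H] := sP x; apply: H; exists y.
have [S [S' [SS' nS nS']]] := disjoint_not_sigma_discrete wo cseg uncT qP q_lt.
exists T, q, S, S'; split=> // x y.
have [xy|/qP] := boolP (le x y); last by constructor 2.
have [yx|/qP] := boolP (le y x); last by constructor 3.
constructor 1; apply: (@wo_chain_antisymmetric _ le predT (withinW wo)) => //.
by rewrite xy.
Qed.

(** * Continuity of partial functions and the two preorders *)

Lemma pcontinuousP (X Y : topologicalType) (f : pfun X Y) :
  pcontinuous f <-> forall x y, f x = Some y -> forall V, nbhs y V ->
    \forall x' \near x, forall y', f x' = Some y' -> V y'.
Proof.
split=> [cf x y fx V Vy|cf V oV].
  have [U [oU Uy] UV] : exists2 U, open_nbhs y U & U `<=` V by move: Vy; rewrite nbhsE.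
  have dx : dom f x by rewrite /dom /= fx.
  have := cf U oU; rewrite openE => /(_ x); rewrite /= fx.
  move=> /(_ (ex_intro2 _ _ y Uy erefl)); rewrite /interior /nbhs /=.
  rewrite -nbhs_subspace_in // => W.
  apply: (@filterS _ (nbhs x)) W => x' H y' fx'; apply: UV.
  have [|z Uz] := H; first by rewrite /dom /= fx'.
  by rewrite fx' => -[<-].
rewrite openE => x [y Vy fx]; rewrite /interior /nbhs /= -nbhs_subspace_in.
  apply: filterS (cf _ _ (esym fx) V (open_nbhs_nbhs (conj oV Vy))) => x' H.
  by rewrite /dom /=; case E: (f x') => [y'|//] _; exists y' => //; exact: H.
by rewrite /dom /= -fx.
Qed.

Lemma pcontinuous_comp (X Y Z : topologicalType) (g : pfun Y Z) (f : pfun X Y) :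
  pcontinuous f -> pcontinuous g -> pcontinuous (pcomp g f).
Proof.
move=> /pcontinuousP cf /pcontinuousP cg; apply/pcontinuousP => x z.
rewrite /pcomp; case E: (f x) => [y|//] /= gy V Vz.
apply: filterS (cf _ _ E _ (cg _ _ gy _ Vz)) => x' H z'.
by case E': (f x') => [y'|//] /=; exact: H.
Qed.

Lemma le0_trans (Z : topologicalType) (P Q R : problem0 Z) :
  le0 P Q -> le0 Q R -> le0 P R.
Proof.
move=> [G1 [cG1 G1P]] [G2 [cG2 G2P]]; exists (pcomp G2 G1).
split; first exact: pcontinuous_comp.
move=> r /G2P/G1P; congr p0_set; apply/funext => x.
by rewrite /pcomp; case: (G1 x).
Qed.

Lemma pcontinuous_total (X Y : topologicalType) (f : X -> Y) :
  continuous f -> pcontinuous (Some \o f : pfun X Y).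
Proof.
move=> cf; apply/pcontinuousP => x _ [<-] V Vfx.
by apply: (@filterS _ (nbhs x) _ (f @^-1` V)) (cf x _ Vfx) => x' Vx' _ [<-].
Qed.

Lemma pcontinuous_Some (X : topologicalType) : pcontinuous (Some : pfun X X).
Proof. by apply: (@pcontinuous_total _ _ id) => x; exact: cvg_id. Qed.

Lemma le2_refl (P : problem) : le2 P P.
Proof.
exists (fun xy => Some xy.2), Some; split.
- apply/pcontinuousP => -[x y] _ [<-] V Vy.
  by exists (setT, V) => [|[x' y'] [_ Vy'] _ [<-]]; first by split=> //; exact: filterT.
- exact: pcontinuous_Some.
- move=> g; congr p_set; apply/funext => x.
  by rewrite /pcomp /pgraph /=; case: (g x).
Qed.

Lemma le2_trans (P Q R : problem) : le2 P Q -> le2 Q R -> le2 P R.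
Proof.
move=> [F1 [G1 [cF1 cG1 H1]]] [F2 [G2 [cF2 cG2 H2]]].
(* [G1] recomputes the query [y] to the middle problem, [F2] turns [z] into an answer [u] to it, and
   [F1] finishes from [u]. *)
exists (fun xz => obind (fun y => obind (fun u => F1 (xz.1, u)) (F2 (y, xz.2)))
                        (G1 xz.1)), (pcomp G2 G1); split.
- move/pcontinuousP in cF1; move/pcontinuousP in cF2; move/pcontinuousP in cG1.
  apply/pcontinuousP => -[x z] v /=.
  case EG: (G1 x) => [y|//] /=; case EF: (F2 (y, z)) => [u|//] /= F1v V Vv.
  have [[A B] [/= Ax Bu] AB] := cF1 _ _ F1v _ Vv.
  have [[A' B'] [/= Ay Bz] AB'] := cF2 _ _ EF _ Bu.
  have Ax' := cG1 _ _ EG _ Ay.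
  exists (A `&` [set x' | forall y', G1 x' = Some y' -> A' y'], B').
    by split=> //; exact: filterI.
  move=> [x' z'] [/= [Ax'' H] Bz'] v'.
  case EG': (G1 x') => [y'|//] /=; case EF': (F2 (y', z')) => [u'|//] /=.
  apply: (AB (x', u')); split=> //=.
  by apply: (AB' (y', z')) EF'; split=> //=; exact: H.
- exact: pcontinuous_comp.
- move=> r /H2/H1; congr p_set; apply/funext => x; rewrite /pcomp /pgraph /=.
  case E: (G1 x) => [y|//] /=; case: (G2 y) => [w|//] /=; case: (r w) => [z|//] /=.
  by rewrite E /=; case: (F2 _).
Qed.

(** * Disjoint sums of topological spaces *)

Definition sum_space (X Y : Type) : Type := (X + Y)%type.

HB.instance Definition _ (X Y : choiceType) := Choice.copy (sum_space X Y) (X + Y)%type.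

Section sum_topology.
Variables X Y : topologicalType.

Definition sum_nbhs (s : sum_space X Y) : set_system (sum_space X Y) :=
  match s with inl x => inl @ nbhs x | inr y => inr @ nbhs y end.

HB.instance Definition _ := hasNbhs.Build (sum_space X Y) sum_nbhs.

Let sum_nbhs_proper s : ProperFilter (sum_nbhs s).
Proof. by case: s => s; exact: fmap_proper_filter. Qed.

Let sum_nbhs_singleton s A : sum_nbhs s A -> A s.
Proof. by case: s => s; exact: nbhs_singleton. Qed.

Let sum_nbhs_nbhs s A : sum_nbhs s A -> sum_nbhs s (sum_nbhs^~ A).
Proof. by case: s => s; exact: nbhs_interior. Qed.

HB.instance Definition _ := Nbhs_isNbhsTopological.Build (sum_space X Y)
  sum_nbhs_proper sum_nbhs_singleton sum_nbhs_nbhs.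

Definition inl_ext (Z : Type) (f : pfun X Z) : pfun (sum_space X Y) Z :=
  fun s => if s is inl x then f x else None.

Definition inr_ext (Z : Type) (g : pfun Y Z) : pfun (sum_space X Y) Z :=
  fun s => if s is inr y then g y else None.

Lemma pcontinuous_inl_ext (Z : topologicalType) (f : pfun X Z) :
  pcontinuous f -> pcontinuous (inl_ext f).
Proof.
move=> /pcontinuousP cf; apply/pcontinuousP => -[x|//] z fx V Vz.
exact: cf fx _ Vz.
Qed.

Lemma pcontinuous_inr_ext (Z : topologicalType) (g : pfun Y Z) :
  pcontinuous g -> pcontinuous (inr_ext g).
Proof.
move=> /pcontinuousP cg; apply/pcontinuousP => -[//|y] z gy V Vz.
exact: cg gy _ Vz.
Qed.

End sum_topology.

Lemma pcontinuous_inlK (X Y : topologicalType) :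
  pcontinuous (inl_ext Some : pfun (sum_space X Y) X).
Proof. exact/pcontinuous_inl_ext/pcontinuous_Some. Qed.

Lemma pcontinuous_inrK (X Y : topologicalType) :
  pcontinuous (inr_ext Some : pfun (sum_space X Y) Y).
Proof. exact/pcontinuous_inr_ext/pcontinuous_Some. Qed.

Lemma inl_continuous (X Y : topologicalType) : continuous (inl : X -> sum_space X Y).
Proof. by move=> ? ?. Qed.

Lemma inr_continuous (X Y : topologicalType) : continuous (inr : Y -> sum_space X Y).
Proof. by move=> ? ?. Qed.

(** * The two-element problem below two functions *)

Definition meet0 (Z : topologicalType) (f g : func0 Z) : problem0 Z :=
  @Problem0 Z (sum_space (f0_in f) (f0_in g))
    [set u | u = inl_ext (f0_fun f) \/ u = inr_ext (f0_fun g)].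

Lemma meet0_lel (Z : topologicalType) (f g : func0 Z) :
  le0 (meet0 f g) (sing0 f).
Proof.
exists (inl_ext Some); split; first exact: pcontinuous_inlK.
by move=> _ ->; left; apply/funext => -[].
Qed.

Lemma meet0_ler (Z : topologicalType) (f g : func0 Z) :
  le0 (meet0 f g) (sing0 g).
Proof.
exists (inr_ext Some); split; first exact: pcontinuous_inrK.
by move=> _ ->; right; apply/funext => -[].
Qed.

(** The one function [h] composed with [G] must be one of the two elements; restricting [G] to the
    matching summand gives the reduction. *)
Lemma meet0_le_sing (Z : topologicalType) (f g h : func0 Z) :
  le0 (meet0 f g) (sing0 h) -> fle0 f h \/ fle0 g h.
Proof.
move=> [G [cG /(_ _ erefl)]]; case=> E; [left|right].
- exists (pcomp G (Some \o inl)); split.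
    by apply: pcontinuous_comp cG; exact/pcontinuous_total/inl_continuous.
  by move=> _ ->; apply/funext => x; have /(congr1 (@^~ (inl x))) := E.
- exists (pcomp G (Some \o inr)); split.
    by apply: pcontinuous_comp cG; exact/pcontinuous_total/inr_continuous.
  by move=> _ ->; apply/funext => x; have /(congr1 (@^~ (inr x))) := E.
Qed.

Lemma not_infimum_le0 (Z : topologicalType) (f g h : func0 Z) :
  ~ fle0 f g -> ~ fle0 g f ->
  ~ is_infimum (@le0 Z) (sing0 h) (sing0 f) (sing0 g).
Proof.
move=> nfg ngf [hf hg /(_ _ (meet0_lel f g) (meet0_ler f g))].
case/meet0_le_sing => [fh|gh].
  by apply: nfg; exact: le0_trans hg.
by apply: ngf; exact: le0_trans hf.
Qed.

(** Outputs are tagged as well, since [f] and [g] may have different codomains. *)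
Definition meet2 (f g : func) : problem :=
  @Problem (sum_space (f_in f) (f_in g)) (sum_space (f_out f) (f_out g))
    [set u | u = inl_ext (pcomp (Some \o inl) (f_fun f)) \/
             u = inr_ext (pcomp (Some \o inr) (f_fun g))].

Lemma meet2_lel (f g : func) : le2 (meet2 f g) (sing f).
Proof.
exists (Some \o (inl \o snd)), (inl_ext Some); split.
- apply: pcontinuous_total => x; apply: continuous_comp; last exact: inl_continuous.
  exact: cvg_snd.
- exact: pcontinuous_inlK.
- move=> _ ->; left; apply/funext => -[x|//].
  by rewrite /pcomp /pgraph /=; case: (f_fun f x).
Qed.

Lemma meet2_ler (f g : func) : le2 (meet2 f g) (sing g).
Proof.
exists (Some \o (inr \o snd)), (inr_ext Some); split.
- apply: pcontinuous_total => x; apply: continuous_comp; last exact: inr_continuous.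
  exact: cvg_snd.
- exact: pcontinuous_inrK.
- move=> _ ->; right; apply/funext => -[//|x].
  by rewrite /pcomp /pgraph /=; case: (f_fun g x).
Qed.

Lemma meet2_le_sing (f g h : func) :
  le2 (meet2 f g) (sing h) -> fle2 f h \/ fle2 g h.
Proof.
move=> [F [G [cF cG /(_ _ erefl)]]]; case=> E; [left|right].
- pose i (xy : f_in f * f_out h) : sum_space (f_in f) (f_in g) * f_out h :=
    (inl xy.1, xy.2).
  have ci : continuous i.
    move=> [x y] A [[B C] [/= Bx Cy] BC].
    by exists (inl @^-1` B, C) => [|[x' y'] [/= Bx' Cy']]; [split|exact: BC].
  exists (pcomp (@inl_ext (f_out f) (f_out g) _ Some) (pcomp F (Some \o i))).
  exists (pcomp G (Some \o inl)); split.
  + have cFi := pcontinuous_comp (pcontinuous_total ci) cF.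
    exact: (pcontinuous_comp cFi (@pcontinuous_inlK (f_out f) (f_out g))).
  + by apply: pcontinuous_comp cG; exact/pcontinuous_total/inl_continuous.
  + move=> _ ->; apply/funext => x.
    have /(congr1 (@^~ (inl x))) := E; rewrite /pcomp /pgraph /=.
    case: (G _) => [w|] /=; last by case: (f_fun f x).
    case: (f_fun h w) => [y|] /=; last by case: (f_fun f x).
    by rewrite /i /= => ->; case: (f_fun f x).
- pose i (xy : f_in g * f_out h) : sum_space (f_in f) (f_in g) * f_out h :=
    (inr xy.1, xy.2).
  have ci : continuous i.
    move=> [x y] A [[B C] [/= Bx Cy] BC].
    by exists (inr @^-1` B, C) => [|[x' y'] [/= Bx' Cy']]; [split|exact: BC].
  exists (pcomp (@inr_ext (f_out f) (f_out g) _ Some) (pcomp F (Some \o i))).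
  exists (pcomp G (Some \o inr)); split.
  + have cFi := pcontinuous_comp (pcontinuous_total ci) cF.
    exact: (pcontinuous_comp cFi (@pcontinuous_inrK (f_out f) (f_out g))).
  + by apply: pcontinuous_comp cG; exact/pcontinuous_total/inr_continuous.
  + move=> _ ->; apply/funext => x.
    have /(congr1 (@^~ (inr x))) := E; rewrite /pcomp /pgraph /=.
    case: (G _) => [w|] /=; last by case: (f_fun g x).
    case: (f_fun h w) => [y|] /=; last by case: (f_fun g x).
    by rewrite /i /= => ->; case: (f_fun g x).
Qed.

Lemma not_infimum_le2 (f g h : func) : ~ fle2 f g -> ~ fle2 g f ->
  ~ is_infimum le2 (sing h) (sing f) (sing g).
Proof.
move=> nfg ngf [hf hg /(_ _ (meet2_lel f g) (meet2_ler f g))].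
case/meet2_le_sing => [fh|gh].
  by apply: nfg; exact: le2_trans hg.
by apply: ngf; exact: le2_trans hf.
Qed.

(** * Two constants with an infimum for [fle0] *)

Lemma infimum_fle0_ex : exists (Z : topologicalType) (f g h : func0 Z),
  [/\ ~ fle0 f g, ~ fle0 g f & is_infimum (@fle0 Z) h f g].
Proof.
pose cst (b : bool) : func0 bool := @Func0 bool bool (fun=> Some b).
have cst_le b (k : func0 bool) x y : fle0 k (cst b) -> f0_fun k x = Some y -> y = b.
  move=> [G [_ H]]; have <- : pcomp (fun=> Some b) G = f0_fun k by exact: H.
  by rewrite /pcomp; case: (G x) => //= _ [].
have empty_le (f k : func0 bool) : (forall x, f0_fun f x = None) -> fle0 f k.
  move=> f0; exists (fun=> None); split; first exact/pcontinuousP.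
  by move=> u _; apply/funext => x; rewrite f0.
exists bool, (cst true), (cst false), (@Func0 bool bool (fun=> None)); split.
- by move=> tf; have := cst_le _ (cst true) true true tf erefl.
- by move=> ft; have := cst_le _ (cst false) true false ft erefl.
- split; try exact: empty_le.
  move=> k kt kf; apply: empty_le => x; case E: (f0_fun k x) => [y|//].
  by have := cst_le _ _ _ _ kt E; rewrite (cst_le _ _ _ _ kf E).
Qed.

(* A constant [q] gives the indiscrete topology. *)
Definition agree_space (T V : Type) (q : nat -> T -> V) : Type := T.

(** * The topology making countably many functions locally constant *)

Section agree_topology.
Variables (T : choiceType) (V : Type) (q : nat -> T -> V).

HB.instance Definition _ := Choice.copy (agree_space q) T.

Definition agree_nbhs (x : agree_space q) : set_system (agree_space q) :=
  [set A | exists m, agree q m x `<=` A].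

HB.instance Definition _ := hasNbhs.Build (agree_space q) agree_nbhs.

Let agree_nbhs_singleton x A : agree_nbhs x A -> A x.
Proof. by move=> [m]; apply. Qed.

Let agree_nbhs_proper x : ProperFilter (agree_nbhs x).
Proof.
apply: Build_ProperFilter_ex.
  by move=> A /agree_nbhs_singleton Ax; exists x.
split; first by exists 0.
  move=> A B [m mA] [n nB]; exists (maxn m n) => y xy; split.
    by apply: mA => i im; apply: xy; rewrite leq_max im.
  by apply: nB => i im; apply: xy; rewrite leq_max im orbT.
by move=> A B AB [m mA]; exists m; exact: subset_trans AB.
Qed.

Let agree_nbhs_nbhs x A : agree_nbhs x A -> agree_nbhs x (agree_nbhs^~ A).
Proof.
move=> [m mA]; exists m => y xy; exists m => z yz; apply: mA => i im.
by rewrite yz // xy.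
Qed.

HB.instance Definition _ := Nbhs_isNbhsTopological.Build (agree_space q)
  agree_nbhs_proper agree_nbhs_singleton agree_nbhs_nbhs.

End agree_topology.

(** * Two separators with an infimum for [fle2] *)

Section infimum_fle2.
Variables (T : choiceType) (q : nat -> T -> T).
Hypothesis qP : forall x y, [\/ x = y, exists n, q n x = y | exists n, q n y = x].

(* The factor [nat], not seen by the topology, puts [countable_separator] below. *)
Definition separator (S : set T) : func :=
  @Func (agree_space (fun i (x : T * nat) => q i x.1))
        (discrete_topology (T * nat))
        (fun x => if `[< S x.1 >] then Some x else None).

(** Being below it amounts to being continuous on each piece of some countable partition of the
    domain. *)
Definition countable_separator : func :=
  @Func (agree_space (fun (_ _ : nat) => tt)) nat Some.

Lemma countable_separator_le S : S !=set0 ->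
  fle2 countable_separator (separator S).
Proof.
move=> [x Sx].
exists (fun cy => Some cy.2.2), (fun c => Some (x, c)); split.
- apply/pcontinuousP => -[c y] _ [<-] V Vy.
  exists (setT, [set y]); first by split; [exact: filterT|exact: discrete_set1].
  by move=> [c' y'] [_ /= ->] _ [<-]; exact: nbhs_singleton Vy.
- apply/pcontinuousP => c _ [<-] V [m mV].
  by exists 0 => c' _ _ [<-]; apply: mV.
- move=> _ ->; apply/funext => c; rewrite /pcomp /pgraph /=.
  by case: asboolP.
Qed.

(** Colour [x] by the number that [G] assigns to [(x, 0)]. For a fixed colour, [F] is continuous
    into a discrete space and returns the point itself, so each colour class is discrete. *)
Lemma separator_nle S : ~ sigma_discrete q S ->
  ~ fle2 (separator S) countable_separator.
Proof.
move=> nS [F [G [/pcontinuousP cF _ /(_ _ erefl) FG]]]; apply: nS.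
have FGx x : S x -> exists2 c, G (x, 0) = Some c & F ((x, 0), c) = Some (x, 0).
  move=> Sx; have /(congr1 (@^~ (x, 0))) := FG; rewrite /pcomp /pgraph /=.
  by case: asboolP => // _; case: (G _) => [c|//] /= Fc; exists c.
exists (fun x => odflt 0 (G (x, 0))) => x Sx.
have [c Gx Fx] := FGx _ Sx.
have [[A B] [/= [m mA] Bc] AB] := cF _ _ Fx _ (discrete_set1 _).
exists m => y Sy; have [c' Gy Fy] := FGx _ Sy; rewrite Gx Gy /= => cc' xy.
have [] // : (y, 0) = (x, 0).
apply: (AB ((y, 0), c')) => //; split; first exact: mA.
by rewrite cc'; exact: nbhs_singleton Bc.
Qed.

(** Where [k] is defined, [k z] is [F (z, G z)], so [k] is continuous along each set on which [G] is
    constant. *)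
Lemma fle2_separator S (k : func) : fle2 k (separator S) ->
  exists G : pfun (f_in k) (T * nat), forall w v, f_fun k w = Some v ->
    exists x, [/\ G w = Some x, S x.1,
      forall m, \forall z \near w, forall y, G z = Some y -> agree q m x.1 y.1 &
      forall V, nbhs v V -> \forall z \near w, forall v',
        f_fun k z = Some v' -> G z = Some x -> V v'].
Proof.
move=> [F [G [/pcontinuousP cF /pcontinuousP cG /(_ _ erefl) FG]]].
have kE w : f_fun k w = pcomp F (pgraph (pcomp (f_fun (separator S)) G)) w.
  by rewrite FG.
exists G => w v; rewrite kE /pcomp /pgraph /=.
case Gw: (G w) => [x|//] /=; case: asboolP => // Sx Fv; exists x; split=> //.
- by move=> m; apply: (cG _ _ Gw); exists m.
- move=> V Vv; have [[A B] [/= Aw Bx] AB] := cF _ _ Fv _ Vv.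
  apply: filterS Aw => z Az v'; rewrite kE /pcomp /pgraph /= => + Gz.
  rewrite Gz /=; case: asboolP => // _; apply: (AB (z, x)); split=> //.
  exact: nbhs_singleton Bx.
Qed.

Lemma le_countable_separator S S' (k : func) : S `&` S' = set0 ->
  fle2 k (separator S) -> fle2 k (separator S') -> fle2 k countable_separator.
Proof.
move=> SS' /fle2_separator[G GP] /fle2_separator[G' GP'].
(* The code tells which point is [q n] of the other, and stores both second coordinates, which the
   topology does not control. *)
pose coded w (c : bool * nat * nat * nat) := forall x y,
  G w = Some x -> G' w = Some y -> let: (b, n, a, a') := c in
  [/\ x.2 = a, y.2 = a' & if b then q n x.1 = y.1 else q n y.1 = x.1].
have /choice[code codeP] : forall w, exists c,
    forall v, f_fun k w = Some v -> coded w c.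
  move=> w; case kw: (f_fun k w) => [v|]; last by exists (true, 0, 0, 0).
  have [x [Gx Sx _ _]] := GP _ _ kw; have [y [Gy Sy _ _]] := GP' _ _ kw.
  have [xy|[n qn]|[n qn]] := qP x.1 y.1.
  - suff : (S `&` S') x.1 by rewrite SS'.
    by split=> //; rewrite xy.
  - exists (true, n, x.2, y.2) => _ _ x' y'; rewrite Gx Gy => -[<-] [<-].
    by split.
  - exists (false, n, x.2, y.2) => _ _ x' y'; rewrite Gx Gy => -[<-] [<-].
    by split.
(* Defined only when [wc.2] is the code of [wc.1], so that continuity is required on each piece
   separately. *)
exists (fun wc => if pickle (code wc.1) == wc.2 then f_fun k wc.1 else None).
exists (fun w => Some (pickle (code w))); split; last first.
- move=> _ ->; apply/funext => w; rewrite /pcomp /pgraph /=.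
  by rewrite eqxx.
- by apply/pcontinuousP => w _ [<-] V [m mV]; apply: filterE => z _ [<-]; apply: mV.
apply/pcontinuousP => -[w c] v /=; case: eqP => // wc kw V Vv.
have [x [Gx Sx Gagree GV]] := GP _ _ kw.
have [y [Gy Sy Gagree' GV']] := GP' _ _ kw.
have := codeP _ _ kw _ _ Gx Gy.
case E: (code w) => [[[b n] a] a'] [xa ya' qn].
set A := [set z | forall v', f_fun k z = Some v' -> code z = code w -> V v'].
suff Aw : nbhs w A.
  exists (A, [set c]); first by split=> //; exact: discrete_set1.
  move=> [z c'] [/= Az ->] v'; case: eqP => // zc kz; apply: (Az v' kz).
  by apply: (pcan_inj pickleK); rewrite zc wc.
(* Agreement up to [n.+1] includes [q n] itself. *)
move: (GV _ Vv) (GV' _ Vv) (Gagree n.+1) (Gagree' n.+1) => H1 H2 H3 H4.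
apply: filterS (filterI (filterI H1 H2) (filterI H3 H4)) => z.
move=> [[Gz Gz'] [az az']] v' kz cz.
have [x' [Gx' _ _ _]] := GP _ _ kz; have [y' [Gy' _ _ _]] := GP' _ _ kz.
have := codeP _ _ kz _ _ Gx' Gy'; rewrite cz E => -[xa' ya'' qn'].
(* If [b] holds, [y.1] is [q n x.1], which is locally constant as [x] varies continuously, so [G']
   is locally constant on the piece; otherwise [G] is. *)
move: E qn qn'; case: b => _ qn qn'.
- apply: Gz' => //; rewrite Gy'; congr Some.
  rewrite (surjective_pairing y) (surjective_pairing y') ya' ya'' -qn -qn'.
  by rewrite (az _ Gx').
- apply: Gz => //; rewrite Gx'; congr Some.
  rewrite (surjective_pairing x) (surjective_pairing x') xa xa' -qn -qn'.
  by rewrite (az' _ Gy').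
Qed.

End infimum_fle2.

Lemma infimum_fle2_ex : exists f g h : func,
  [/\ ~ fle2 f g, ~ fle2 g f & is_infimum fle2 h f g].
Proof.
have [T [q [S [S' [qP SS' nS nS']]]]] := disjoint_not_sigma_discrete_ex.
have ne (A : set T) : ~ sigma_discrete q A -> A !=set0.
  move=> nA; apply/set0P/eqP => A0; apply: nA; rewrite A0.
  exact: sigma_discrete_countable.
have inf k := @le_countable_separator T q qP S S' k SS'.
exists (separator q S), (separator q S'), countable_separator; split.
(* If one separator were below the other, it would be below both, hence below
   [countable_separator]. *)
- by move=> le; apply: (separator_nle nS); apply: inf le; exact: le2_refl.
- by move=> le; apply: (separator_nle nS'); apply: inf le _; exact: le2_refl.
- by split=> //; apply: countable_separator_le; exact: ne.
Qed.

Theorem theorem4p20 :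
  (* i = 0 *)
  ((forall (Z : topologicalType) (f g h : func0 Z),
      ~ fle0 f g -> ~ fle0 g f ->
      is_infimum (@fle0 Z) h f g ->
      ~ is_infimum (@le0 Z) (sing0 h) (sing0 f) (sing0 g))
   /\ (exists (Z : topologicalType) (f g h : func0 Z),
         is_infimum (@fle0 Z) h f g /\
         ~ is_infimum (@le0 Z) (sing0 h) (sing0 f) (sing0 g)))
  /\
  (* i = 2 *)
  ((forall f g h : func,
      ~ fle2 f g -> ~ fle2 g f ->
      is_infimum fle2 h f g ->
      ~ is_infimum le2 (sing h) (sing f) (sing g))
   /\ (exists f g h : func,
         is_infimum fle2 h f g /\
         ~ is_infimum le2 (sing h) (sing f) (sing g))).
Proof.
split; split.
- by move=> Z f g h nfg ngf _; exact: not_infimum_le0.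
- have [Z [f [g [h [nfg ngf inf]]]]] := infimum_fle0_ex.
  by exists Z, f, g, h; split=> //; exact: not_infimum_le0.
- by move=> f g h nfg ngf _; exact: not_infimum_le2.
- have [f [g [h [nfg ngf inf]]]] := infimum_fle2_ex.
  by exists f, g, h; split=> //; exact: not_infimum_le2.
Qed.
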